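(* Let $q=2^m$ and $r=2^h$ with $h\mid m$ and $q/r>2$. Let $F=\mathbb{F}_q$, $K=\mathbb{F}_{q^2}$, $F'=\mathbb{F}_r$, and let $U\subset K$ be the set defined in the context. Let $V_1=\{x\in F\mid Tr_{F/F'}(x)=1\}$, let $c\in K^*$ be arbitrary, put $V_c=cV_1$, and let $$H_r=\{\lambda u\mid 1/\lambda\in V_c,\ u\in U\}\subset K=AG(2,q),$$ which is a KM-arc of type $t=q/r$ with $t$-nucleus at $0$. Let $l_0$ be the line $\langle 1,z\rangle=0$. Then $H_r$ is a translation KM-arc with translation line $l_0$.
   Context: Relative trace: $Tr_{F/F'}:F\to F'$, $Tr_{F/F'}(x)=x+x^r+\cdots+x^{q/r^2}+x^{q/r}$. Definition of $U$: let $K'=\mathbb{F}_{r^2}$ with $F'\subset K'\subseteq K$ and let $S'$ be the group of $(r+1)$-st roots of unity in $K'$. Let $\mathbf{u}$ be a generator of $S'$, $\tilde{\mathbf u}=\mathbf u^r$, and $b=\mathbf u+\tilde{\mathbf u}\in F'$. Let $(b_n)_{n\ge0}$ be the sequence in $F'$ given by $b_0=1$, $b_1=0$, $b_{n+1}=bb_n+b_{n-1}$. Fix $\mathbf i\in K$ with $\mathbf i+\mathbf i^q=1$; then $1,\mathbf i$ is a basis of $K$ over $F$. Put $u_i=b_i+b_{i+1}\mathbf i$ and $U=\{u_i\mid 0\le i\le r\}$. Representation of the plane: put $\bar x=x^q$, $\langle x,y\rangle=x\bar y+\bar xy\in F$ and $S=\{u\in K\mid u\bar u=1\}$. Points of $PG(2,q)$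 are pairs $(x:z)$ with $x\in K$, $z\in F$, $(x,z)\neq(0,0)$, up to multiplication by $F^*$; lines are $[\alpha:\beta]=\{(x:z)\mid\langle\alpha,x\rangle+\beta z=0\}$, $\alpha\in K$, $\beta\in F$, $(\alpha,\beta)\ne(0,0)$. The affine plane $AG(2,q)=PG(2,q)\setminus[0:1]$ is identified with $K$ via $(x:1)\leftrightarrow x$; its lines are $\{x\in K\mid\langle u,x\rangle+\mu=0\}$ with $u\in S$, $\mu\in F$. Writing $z=x+y\mathbf i$ with $x,y\in F$, the line $l_0$ is $y=0$ (together with its point at infinity). A KM-arc of type $t$ in $PG(2,q)$ is a set of $q+t$ points meeting every line in $0$, $2$ or $t$ points; for $2<t<q$ all lines meeting it in exactly $t$ points pass through one common point, its $t$-nucleus. An elation with axis a line $l$ and centre a point $R$ on $l$ is a collineation of $PG(2,q)$ which fixes every point of $l$ and stabilises every line through $R$. A KM-arc $H$ of type $t>2$ is a translation KM-arc with translation line $l_0$ if the group of all elations with axis $l_0$ (with any centre on $l_0$) that stabilise $H$ acts transitively on the points of $H\setminus l_0$.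
   Formalization: For arbitrary c the claim fails when l_0 misses H_r (then q+t=t(r+1) points, not a power of 2), so translation line l_0 is asserted only when l_0 meets H_r (e.g. c in F^* ); for every c in K^* the line <1,cz>=0 is shown to be a translation line. *)

(* Defs.v *)
From HB Require Import structures.
From mathcomp Require Import all_boot all_order all_fingroup all_algebra all_solvable all_field.

Set Implicit Arguments.
Unset Strict Implicit.
Unset Printing Implicit Defensive.

Import GRing.Theory.
Local Open Scope ring_scope.

(* The subfield of order n of K, given as the set of roots of X^n - X.  When
   #|K| is a power of n > 1 it is indeed a subfield, of order n: see
   subGF_divring_closed and card_subGF. *)
Definition subGF (K : finFieldType) (n : nat) : {set K} := [set x | x ^+ n == x].

Lemma subGF_divring_closed (K : finFieldType) (k d : nat) :
  #|K| = (2 ^ d)%N -> divring_closed [in subGF K (2 ^ k)].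
Proof.
move=> cK; have ch2 : 2%N \in [pchar K] by apply: card_finPcharP cK _.
have c2 : [pchar K].-nat (2 ^ k)%N by rewrite pnatX pnatE ?ch2.
split=> [|x y|x y]; rewrite !inE.
- by rewrite expr1n.
- move=> /eqP ex /eqP ey.
  by rewrite -[- y]oppr_pchar2 // opprK exprDn_pchar // ex ey.
- by move=> /eqP ex /eqP ey; rewrite expr_div_n ex ey.
Qed.

Lemma card_subGF (K : finFieldType) (n d : nat) :
  (1 < n)%N -> #|K| = (n ^ d)%N -> #|subGF K n| = n.
Proof.
move=> n1 cK; pose P k : {poly K} := 'X^(n ^ k) - 'X.
have dvP k : P 1%N %| P k.
  elim: k => [|k IHk]; first by rewrite /P expn0 expr1 subrr dvdp0.
  have -> : P k.+1 = ('X^(n ^ k) ^+ n - 'X^n) + P 1%N.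
    by rewrite /P expn1 -exprM mulnC -expnS addrA subrK.
  by rewrite dvdp_addl // subrXX; apply: dvdp_mulr.
have := dvP d; rewrite /P -cK finField_genPoly expn1.
rewrite -big_enum /= => /dvdp_prod_XsubC [m eqm].
have uq : uniq (mask m (enum K)) by rewrite mask_uniq ?enum_uniq.
have sz : size ('X^n - 'X : {poly K}) = n.+1.
  by rewrite size_polyDl size_polyXn // size_polyN size_polyX.
have := eqp_size eqm; rewrite sz size_prod_XsubC => -[nE].
rewrite [RHS]nE -(card_uniqP uq); apply: eq_card => x.
rewrite inE -root_prod_XsubC -(eqp_root eqm) rootE !hornerE.
by rewrite subr_eq0.
Qed.

(* Tr x = x + x^r + ... + x^(r^(n-1)), where n is the degree of the extension. *)
Definition rel_trace (K : finFieldType) (r n : nat) (x : K) : K :=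
  \sum_(i < n) x ^+ (r ^ i).

(* qconj q x is the conjugate x^q of x, and ip q x y the bilinear form <x, y>. *)
Definition qconj (K : finFieldType) (q : nat) (x : K) : K := x ^+ q.

Definition ip (K : finFieldType) (q : nat) (x y : K) : K :=
  x * qconj q y + qconj q x * y.

(* Homogeneous coordinates, over the subfield F of order q: (x, z) <> (0, 0)
   with x in K and z in F; they serve for points and for lines. *)
Definition hcoord (K : finFieldType) (q : nat) : {set K * K} :=
  [set p : K * K | (p.2 \in subGF K q) && (p != 0)].

(* The class of (x, z) up to multiplication by F^*. *)
Definition hclass (K : finFieldType) (q : nat) (p : K * K) : {set K * K} :=
  [set (s * p.1, s * p.2) | s in subGF K q :\ 0].

Definition pgpoint (K : finFieldType) (q : nat) :=
  {P : {set K * K} | P \in hclass q @: hcoord K q}.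

Definition pgline (K : finFieldType) (q : nat) (a b : K) : {set pgpoint K q} :=
  [set P : pgpoint K q | [forall p in val P, ip q a p.1 + b * p.2 == 0]].

Definition pglines (K : finFieldType) (q : nat) : {set {set pgpoint K q}} :=
  [set pgline q a.1 a.2 | a in hcoord K q].

Lemma affine_hcoord (K : finFieldType) (q : nat) (x : K) : (x, 1) \in hcoord K q.
Proof.
rewrite !inE expr1n eqxx /=; apply/eqP => /(congr1 snd) /= /eqP.
by rewrite oner_eq0.
Qed.

(* The affine point (x : 1). *)
Definition affine (K : finFieldType) (q : nat) (x : K) : pgpoint K q :=
  exist _ (hclass q (x, 1)) (imset_f (hclass q) (affine_hcoord q x)).

Definition is_KM_arc (K : finFieldType) (q t : nat) (H : {set pgpoint K q}) : Prop :=
  #|H| = (q + t)%N /\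
  forall l, l \in pglines K q -> #|H :&: l| \in [:: 0; 2; t]%N.

Definition is_t_nucleus (K : finFieldType) (q t : nat) (H : {set pgpoint K q})
    (N : pgpoint K q) : Prop :=
  forall l, l \in pglines K q -> #|H :&: l| = t -> N \in l.

Definition is_collineation (K : finFieldType) (q : nat)
    (g : {perm pgpoint K q}) : bool :=
  [forall l in pglines K q, g @: l \in pglines K q].

Definition is_elation (K : finFieldType) (q : nat) (l : {set pgpoint K q})
    (R : pgpoint K q) (g : {perm pgpoint K q}) : bool :=
  [&& is_collineation g, [forall P in l, g P == P]
    & [forall l' in pglines K q, (R \in l') ==> (g @: l' == l')]].

Definition elations (K : finFieldType) (q : nat) (l : {set pgpoint K q}) :
    {set {perm pgpoint K q}} :=
  [set g | [exists R in l, is_elation l R g]].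

Definition is_translation_KM_arc (K : finFieldType) (q t : nat)
    (H l : {set pgpoint K q}) : Prop :=
  [/\ (2 < t)%N, is_KM_arc t H, l \in pglines K q
    & [transitive [set g in elations l | g @: H == H], on H :\: l | 'P]].

(* The group of (r+1)-st roots of unity in the subfield of order r^2. *)
Definition Sprime (K : finFieldType) (r : nat) : {set K} :=
  [set x in subGF K (r ^ 2) | x ^+ r.+1 == 1].

Definition generates (K : finFieldType) (u : K) (A : {set K}) : Prop :=
  u \in A /\ forall x, x \in A -> exists k, x = u ^+ k.

Fixpoint bseq (K : finFieldType) (b : K) (n : nat) : K :=
  match n with
  | 0 => 1
  | n'.+1 => if n' is n''.+1 then b * bseq b n' + bseq b n'' else 0
  end.

Definition Uset (K : finFieldType) (r : nat) (u ii : K) : {set K} :=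
  [set bseq (u + u ^+ r) i + bseq (u + u ^+ r) i.+1 * ii | i : 'I_r.+1].

Definition V1 (K : finFieldType) (q r n : nat) : {set K} :=
  [set x in subGF K q | rel_trace r n x == 1].

Definition Vc (K : finFieldType) (q r n : nat) (c : K) : {set K} :=
  [set c * x | x in V1 K q r n].

(* The (vacuous) case lam = 0 is excluded since 0 is not in Vc when c <> 0. *)
Definition Hr (K : finFieldType) (q r n : nat) (u ii c : K) : {set K} :=
  [set lam * w | lam in [set lam : K | lam^-1 \in Vc q r n c], w in Uset r u ii].

(* Main.v *)
Require Import Defs.
From mathcomp Require Import all_boot all_order all_fingroup all_algebra all_solvable all_field.
From mathcomp Require Import ring.

Set Implicit Arguments.
Unset Strict Implicit.
Unset Printing Implicit Defensive.

Import GRing.Theory.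
Local Open Scope ring_scope.

(** Write c * z = x + y * ii with x, y in F.  In the coordinates (x, y) the set U
consists of the vectors of norm 1 of the plane F'^2 for the quadratic form
Q (x, y) = x^2 + b x y + y^2: sending (x, y) to x + u y identifies F'^2 with the
field of order r^2 and Q with its norm to F' (norm_formE), and the pairs
(b_i, b_(i+1)) correspond to the powers of u (bseq_generator), that is to all
elements of norm 1 (conicE).  Hence Q is anisotropic, and U is a conic of
AG(2, r) with r + 1 points whose nucleus is the origin.  A point of H has
homogeneous coordinates (c^-1 (x + y ii) : v) with (x, y) in U and Tr v = 1
(arcE); up to scalars in F' these are the solutions of

  Tr (v)^2 = Q (x, y),  (x, y) in F'^2 nonzero, v in F    (cone_in_arc).

Counting points on a line.  The trace takes the value 1 exactly t = q / r times
(card_rel_trace_fibre), so H has t (r + 1) = q + t points.  A line through the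
origin contains the t points over each (x, y) in U that lies on it, and there is
at most one of those because the origin is the nucleus (card_conic_tangent).  On
any other line v is a linear function of (x, y), and the condition Tr v = 1 reads
A x + B y = 1 with A, B in F': it has no solution if A = B = 0, and otherwise it is
a line of AG(2, r) off the nucleus, which meets U in 0 or 2 points
(card_conic_secant).

Translation lines.  Let w be in U, let l be the line joining the origin to w, and
put det p = p.1 * w.2 + p.2 * w.1.  The elations with axis l that matter are

  (p : v) |-> (p + al (det p) w : v + be (det p)),  al in F', be in F.

The polar form of Q is b times the determinant and Q w = 1, hence the first
component changes Q by (det p)^2 (al^2 + b al), while Tr (v)^2 changes by
(det p)^2 Tr (be)^2.  So the elation preserves H as soon as
Tr (be)^2 = al^2 + b al (axis_elation_arc).  Given two points of H off l, rescale
them so that det p = 1; their difference is then (al w, be) for some al and be, and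
the difference of their cone equations is precisely that condition.  This gives an
admissible elation that carries one to the other (arc_swap).  Thus every line through
the origin that meets H is a translation line; the line y = 0 is the case w = (1, 0),
and the line <1, z> = 0 is another one as soon as it meets H. *)

(** * Fields of characteristic two *)

Section Char2.

Variable K : finFieldType.
Hypothesis ch2 : 2%N \in [pchar K].
Implicit Types x y : K.

Lemma addxx x : x + x = 0.
Proof. exact: addrr_pchar2. Qed.

Lemma addr_eq0_char2 x y : (x + y == 0) = (x == y).
Proof. by rewrite addr_eq0 oppr_pchar2. Qed.

(** Lets the [ring] tactic prove identities that hold only modulo 2: z is half the
integral difference of the two sides. *)
Lemma eq_mod2 z x y : x - y = 2%:R * z -> x = y.
Proof. by move/eqP; rewrite [2%:R]addxx mul0r subr_eq0 => /eqP. Qed.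

Lemma expr2kD k x y : (x + y) ^+ (2 ^ k) = x ^+ (2 ^ k) + y ^+ (2 ^ k).
Proof. by apply: exprDn_pchar => //; rewrite pnatX pnatE ?ch2. Qed.

Lemma subGF0 k : 0 \in subGF K (2 ^ k).
Proof. by rewrite inE expr0n expn_eq0. Qed.

Lemma subGF1 n : 1 \in subGF K n.
Proof. by rewrite inE expr1n. Qed.

Lemma subGFD k : {in subGF K (2 ^ k) &, forall x y, x + y \in subGF K (2 ^ k)}.
Proof. by move=> x y; rewrite !inE expr2kD => /eqP-> /eqP->. Qed.

Lemma subGFM n : {in subGF K n &, forall x y, x * y \in subGF K n}.
Proof. by move=> x y; rewrite !inE exprMn => /eqP-> /eqP->. Qed.

Lemma subGF_pairD k (A := setX (subGF K (2 ^ k)) (subGF K (2 ^ k))) :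
  {in A &, forall p p', p + p' \in A}.
Proof.
by move=> [x y] [x' y'] /setXP[? ?] /setXP[? ?]; apply/setXP; split; apply: subGFD.
Qed.

Lemma subGF_pairZ n (A := setX (subGF K n) (subGF K n)) a p :
  a \in subGF K n -> p \in A -> (a * p.1, a * p.2) \in A.
Proof.
by case: p => x y aF /setXP[? ?]; apply/setXP; split; apply: subGFM.
Qed.

Lemma subGFV n : {in subGF K n, forall x, x^-1 \in subGF K n}.
Proof. by move=> x; rewrite !inE exprVn => /eqP->. Qed.

Lemma subGF_expn n e : {subset subGF K n <= subGF K (n ^ e)}.
Proof.
move=> x; rewrite !inE => /eqP xn; elim: e => [|e IHe]; first by rewrite expr1.
by rewrite expnS exprM xn.
Qed.

(** In characteristic 2 the expression p.1 * w.2 + p.2 * w.1 is the determinant of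
p and w; the coefficient of proportionality is a ratio of coordinates. *)
Lemma proportional_of_det0 n (A := setX (subGF K n) (subGF K n)) p w :
    p \in A -> w \in A -> w != 0 -> p.1 * w.2 + p.2 * w.1 = 0 ->
  exists2 a, a \in subGF K n & p = (a * w.1, a * w.2).
Proof.
case: p w => [x y] [x' y'] /setXP[/= xF yF] /setXP[/= xF' yF'] + /eqP.
rewrite xpair_eqE negb_and addr_eq0_char2 => w0 /eqP d0.
have [y0|y0] := eqVneq y' 0.
  move: w0; rewrite y0 eqxx orbF => x0; exists (x / x'); first by rewrite subGFM ?subGFV.
  move/eqP: d0; rewrite y0 mulr0 eq_sym mulf_eq0 (negPf x0) orbF => /eqP->.
  by rewrite divfK // mulr0.
exists (y / y'); first by rewrite subGFM ?subGFV.
by rewrite divfK // mulrAC -d0 mulfK.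
Qed.

End Char2.

(** * The relative trace *)

Section RelTrace.

Variables (K : finFieldType) (h n : nat).
Hypothesis ch2 : 2%N \in [pchar K].
Local Notation r := (2 ^ h)%N.
Local Notation Tr := (@rel_trace K r n).

Lemma rel_traceD x y : Tr (x + y) = Tr x + Tr y.
Proof.
by rewrite -big_split; apply: eq_bigr => i _; rewrite -expnM expr2kD.
Qed.

Lemma rel_traceZ a x : a \in subGF K r -> Tr (a * x) = a * Tr x.
Proof.
move=> aF; rewrite mulr_sumr; apply: eq_bigr => i _; rewrite exprMn.
by have := subGF_expn i aF; rewrite inE => /eqP->.
Qed.

Lemma rel_trace0 : Tr 0 = 0.
Proof. by apply: (addrI (Tr 0)); rewrite -rel_traceD !addr0. Qed.

Lemma rel_trace_subGF x : x \in subGF K (r ^ n) -> Tr x \in subGF K r.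
Proof.
rewrite !inE => /eqP xq; apply/eqP; rewrite /rel_trace.
have -> : (\sum_(i < n) x ^+ (r ^ i)) ^+ r = \sum_(i < n) x ^+ (r ^ i.+1).
  rewrite (big_morph _ (expr2kD ch2 h) (_ : 0 ^+ r = 0)); last first.
    by rewrite expr0n expn_eq0.
  by apply: eq_bigr => i _; rewrite -exprM mulnC -expnS.
case: n xq => [|k] xq; first by rewrite !big_ord0.
by rewrite big_ord_recr /= xq [RHS]big_ord_recl expn0 expr1 addrC.
Qed.

(** The trace is a polynomial of degree r^(n-1), so each of its r fibres has at most
that many elements; their sizes add up to r^n, so each bound is attained. *)
Lemma card_rel_trace_fibre (e : nat) : (0 < h)%N -> (0 < n)%N ->
    #|K| = ((r ^ n) ^ e)%N ->
  {in subGF K r, forall a,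
    #|[set x in subGF K (r ^ n) | Tr x == a]| = (r ^ n.-1)%N}.
Proof.
move=> h0 n0 cK; have r1 : (1 < r)%N by rewrite -{1}(expn0 2) ltn_exp2l.
pose fibre a := [set x in subGF K (r ^ n) | Tr x == a].
have le_fibre a : (#|fibre a| <= r ^ n.-1)%N.
  pose p : {poly K} := \sum_(i < n) 'X^(r ^ i) - a%:P.
  have pE x : p.[x] = Tr x - a.
    by rewrite !hornerE horner_sum; under eq_bigr do rewrite hornerXn.
  have size_p : size p = (r ^ n.-1).+1.
    rewrite /p; case: n n0 => // k _ /=; rewrite big_ord_recr /= addrAC addrC.
    rewrite size_polyDl ?size_polyXn // ltnS (leq_trans (size_polyD _ _)) //.
    rewrite geq_max size_polyN (leq_trans (size_polyC_leq1 _)) ?expn_gt0 ?(ltnW r1) //.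
    rewrite andbT; apply: (leq_trans (size_sum _ _ _)).
    by apply/bigmax_leqP => i _; rewrite size_polyXn ltn_exp2l.
  have p0 : p != 0 by rewrite -size_poly_eq0 size_p.
  rewrite -ltnS -size_p cardE; apply: max_poly_roots (enum_uniq _) => //.
  apply/allP => x; rewrite mem_enum inE => /andP[_ /eqP tx].
  by rewrite rootE pE tx subrr.
have cF : #|subGF K (r ^ n)| = (r ^ n)%N.
  apply: (card_subGF _ cK); apply: (leq_trans r1).
  exact: (@leq_pexp2l r 1 n (ltnW r1) n0).
have cF' : #|subGF K r| = r by apply: (card_subGF r1); rewrite cK -expnM.
have [_] := @leqif_sum _ [in subGF K r] (fun a => #|fibre a| == r ^ n.-1)%N
  (fun a => #|fibre a|) (fun=> r ^ n.-1)%N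
  (fun a _ => leqif_eq (le_fibre a)).
rewrite sum_nat_const cF' -expnS prednK //.
have -> : (\sum_(a in subGF K r) #|fibre a| = r ^ n)%N.
  rewrite -[RHS]cF -sum1_card.
  rewrite [RHS](partition_big Tr [in subGF K r]) => [|x]; last exact: rel_trace_subGF.
  apply: eq_bigr => a _; rewrite -sum1_card; apply: eq_bigl => x.
  by rewrite inE.
rewrite eqxx => /esym/forall_inP fibreE a aF; exact/eqP/fibreE.
Qed.

End RelTrace.

(** * The conic Q = 1 over the field of order r *)

Definition norm_form (K : finFieldType) (b : K) (p : K * K) : K :=
  p.1 ^+ 2 + b * p.1 * p.2 + p.2 ^+ 2.

Definition conic (K : finFieldType) (r : nat) (b : K) : {set K * K} :=
  [set p in setX (subGF K r) (subGF K r) | norm_form b p == 1].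

Section NormForm.

Variables (K : finFieldType) (b : K).
Local Notation Q := (norm_form b).

(** The polar form of Q is b times the determinant. *)
Lemma norm_formD p p' : 2%N \in [pchar K] ->
  Q (p + p') = Q p + Q p' + b * (p.1 * p'.2 + p'.1 * p.2).
Proof.
move=> ch2; apply: (eq_mod2 ch2 (z := p.1 * p'.1 + p.2 * p'.2)).
by rewrite /norm_form; ring.
Qed.

Lemma norm_formZ a x y : Q (a * x, a * y) = a ^+ 2 * Q (x, y).
Proof. by rewrite /norm_form /=; ring. Qed.

Lemma conicP n p :
  reflect [/\ p.1 \in subGF K n, p.2 \in subGF K n & Q p = 1] (p \in conic n b).
Proof.
case: p => x y; apply: (iffP setIdP) => [[/setXP[? ?] /eqP]|[? ? /eqP]] //.
by split=> //; apply/setXP.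
Qed.

Lemma conic_subGF n p : p \in conic n b -> p \in setX (subGF K n) (subGF K n).
Proof. by case/setIdP. Qed.

Lemma conic_neq0 n p : p \in conic n b -> p != 0.
Proof.
case/conicP => _ _; apply: contra_eq_neq => ->.
by rewrite /norm_form /= !mulr0 !expr0n /= !addr0 eq_sym oner_eq0.
Qed.

End NormForm.

Arguments conicP {K b n p}.

Section Conic.

Variables (K : finFieldType) (h e : nat) (u : K).
Local Notation r := (2 ^ h)%N.
Hypotheses (h_gt0 : (0 < h)%N) (cK : #|K| = ((r ^ 2) ^ e)%N).
Hypothesis gen_u : generates u (Sprime K r).
Local Notation b := (u + u ^+ r).
Local Notation Q := (norm_form b).
Local Notation F' := (subGF K r).
Local Notation C := (conic r b).
Local Notation bs := (@Defs.bseq K b).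

Let ch2 : 2%N \in [pchar K].
Proof. by apply: (@card_finPcharP _ _ (h * 2 * e)) => //; rewrite cK -!expnM mulnA. Qed.

(** The multiplicative group of K is cyclic, so K has a primitive (r+1)-st root of
unity; it lies in S', hence is a power of u, and the order of u is r + 1. *)
Lemma prim_root_generator : (r.+1).-primitive_root u.
Proof.
have r_gt0 : (0 < r)%N by rewrite expn_gt0.
have cK_gt1 : (0 < #|K|.-1)%N by rewrite -subn1 subn_gt0 finNzRing_gt1.
have [z _ prim_z] : exists2 z : K, z \in enum [set~ 0] & (#|K|.-1).-primitive_root z.
  apply/hasP/has_prim_root => //; last 2 first.
  - exact: enum_uniq.
  - by rewrite -cardE cardsC1.
  apply/allP => x; rewrite mem_enum !inE => x0; apply/unity_rootP.
  apply: (mulfI x0); rewrite -exprS prednK ?expf_card ?mulr1 //.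
  by rewrite (ltn_trans _ (finNzRing_gt1 K)).
have dvd : (r.+1 %| #|K|.-1)%N.
  rewrite cK (dvdn_trans _ (dvdn_pred_predX _ _)) // -subn1 -(exp1n 2) subn_sqr.
  by rewrite addn1 dvdn_mull.
have prim_y := dvdn_prim_root prim_z dvd.
set y := z ^+ _ in prim_y.
have yr : y ^+ r.+1 = 1 := prim_expr_order prim_y.
have r2E : (r ^ 2 = (r.+1 * r.-1).+1)%N.
  by case: (r) r_gt0 => // k _; rewrite /= -mulnn; ring.
have yS : y \in Sprime K r by rewrite !inE yr eqxx andbT r2E exprS exprM yr expr1n mulr1.
have [uS uG] := gen_u; have [k yE] := uG _ yS.
have ur : u ^+ r.+1 = 1 by move: uS; rewrite !inE => /andP[_ /eqP].
have [d prim_u d_dvd] := prim_order_exists (ltn0Sn r) ur.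
suff dvd_d : (r.+1 %| d)%N.
  by rewrite (_ : r.+1 = d) //; apply/eqP; rewrite eqn_dvd dvd_d.
rewrite (prim_order_dvd prim_y) yE -exprM mulnC exprM (prim_expr_order prim_u).
by rewrite expr1n.
Qed.

Let prim_u := prim_root_generator.

Lemma generator_conj : (u ^+ r) ^+ r = u.
Proof. by have [] := gen_u; rewrite !inE -exprM -mulnn => /andP[/eqP]. Qed.

Lemma mul_generator_conj : u * u ^+ r = 1.
Proof. by rewrite -exprS (prim_expr_order prim_u). Qed.

Lemma conic_coef_subGF : b \in F'.
Proof. by rewrite inE (expr2kD ch2) generator_conj addrC. Qed.

Lemma generator_notin_subGF : u \notin F'.
Proof.
rewrite inE -{2}(expr1 u) (eq_prim_root_expr prim_u).
have r_gt1 : (1 < r)%N by rewrite -{1}(expn0 2) ltn_exp2l.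
by rewrite !modn_small ?ltnS // 1?ltnW // gtn_eqF.
Qed.

Lemma conic_coef_neq0 : b != 0.
Proof.
by rewrite (addr_eq0_char2 ch2) eq_sym; move: generator_notin_subGF; rewrite inE.
Qed.

(** The two factors are conjugate over F': Q is the norm of p.1 + u * p.2. *)
Lemma norm_formE p : Q p = (p.1 + u * p.2) * (p.1 + u ^+ r * p.2).
Proof.
rewrite /norm_form -[p.2 ^+ 2]mul1r -mul_generator_conj; ring.
Qed.

(** 1 and u are linearly independent over F', since u is not in F'. *)
Lemma generator_free p p' : p \in setX F' F' -> p' \in setX F' F' ->
  p.1 + u * p.2 = p'.1 + u * p'.2 -> p = p'.
Proof.
case: p p' => [x y] [x' y'] /setXP[/= xF yF] /setXP[/= xF' yF'] E.
have E1 : x + x' = u * (y + y').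
  apply: (eq_mod2 ch2 (z := x' - u * y)); move/eqP: E; rewrite -subr_eq0 => /eqP E.
  by rewrite -[RHS]addr0 -E; ring.
have [yy|yy] := eqVneq y y'.
  by move: E; rewrite yy => /addIr->.
have d0 : y + y' != 0 by rewrite (addr_eq0_char2 ch2).
case/negP: generator_notin_subGF.
rewrite -(mulfK d0 u) -E1; apply: subGFM; first exact: subGFD.
by apply: subGFV; apply: subGFD.
Qed.

Lemma norm_form_anisotropic p : p \in setX F' F' -> Q p = 0 -> p = 0.
Proof.
move=> pF /eqP; rewrite norm_formE mulf_eq0 => p0.
have zF : (0, 0) \in setX F' F' by rewrite inE /= subGF0.
apply: (generator_free pF zF); rewrite /= mulr0 addr0.
case/orP: p0 => /eqP //; move: pF; rewrite !inE => /andP[/eqP xF /eqP yF].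
move/(congr1 (fun z => z ^+ r)); rewrite (expr2kD ch2) exprMn generator_conj.
by rewrite xF yF expr0n expn_eq0.
Qed.

Lemma bseq_subGF i : bs i \in F'.
Proof.
elim/ltn_ind: i => -[|[|i]] IH; [exact: subGF1|exact: subGF0|].
have -> : bs i.+2 = b * bs i.+1 + bs i by [].
by apply: (subGFD ch2); first apply: subGFM conic_coef_subGF _; apply: IH.
Qed.

Lemma bseq_setX i : (bs i, bs i.+1) \in setX F' F'.
Proof. by apply/setXP; split; [apply: (bseq_subGF i) | apply: (bseq_subGF i.+1)]. Qed.

(** u is a root of X^2 + b X + 1, so that shifting the pair (b_i, b_(i+1)) along the
recurrence amounts to multiplying b_i + u b_(i+1) by u. *)
Lemma bseq_generator i : bs i + u * bs i.+1 = u ^+ i.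
Proof.
elim: i => [|i IH]; first by rewrite /= mulr0 addr0.
rewrite exprS -IH; have -> : bs i.+2 = b * bs i.+1 + bs i by [].
apply: (eq_mod2 ch2 (z := bs i.+1)).
transitivity ((1 + u * u ^+ r) * bs i.+1); first by ring.
by rewrite mul_generator_conj; ring.
Qed.

(** Both sides correspond to the group of elements of norm 1, all powers of u. *)
Lemma conicE : C = [set (bs i, bs i.+1) | i : 'I_r.+1].
Proof.
apply/setP => -[x y]; apply/idP/imsetP => [|[i _ [-> ->]]].
  rewrite inE => /andP[pF /eqP]; rewrite norm_formE /= => N1.
  have xyS : x + u * y \in Sprime K r.
    have conjE : (x + u * y) ^+ r = x + u ^+ r * y.
      move: pF; rewrite !inE /= => /andP[/eqP xF /eqP yF].
      by rewrite (expr2kD ch2) exprMn xF yF.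
    rewrite !inE -mulnn exprM conjE exprS conjE N1 eqxx andbT.
    move: pF; rewrite !inE /= => /andP[/eqP xF /eqP yF].
    by rewrite (expr2kD ch2) exprMn xF yF generator_conj.
  have [k xyE] := gen_u.2 _ xyS.
  exists (Ordinal (ltn_pmod k (ltn0Sn r))) => //.
  apply: (generator_free pF (bseq_setX _)).
  by rewrite [LHS]xyE [RHS]bseq_generator (prim_expr_mod prim_u).
rewrite inE; apply/andP; split; first exact: bseq_setX.
rewrite norm_formE [X in X * _]bseq_generator.
have -> : bs i + u ^+ r * bs i.+1 = (u ^+ i) ^+ r.
  rewrite -(bseq_generator i) (expr2kD ch2) exprMn.
  by have:= bseq_subGF i; have := bseq_subGF i.+1; rewrite !inE => /eqP-> /eqP->.
by rewrite exprAC -exprMn mul_generator_conj expr1n.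
Qed.

Lemma card_conic : #|C| = r.+1.
Proof.
rewrite conicE card_imset ?card_ord // => i j /= [Eij Eij1].
have /eqP : u ^+ i = u ^+ j.
  by rewrite -(bseq_generator i) -(bseq_generator j) Eij [bs i.+1]Eij1.
rewrite (eq_prim_root_expr prim_u) !modn_small // => /eqP; exact: val_inj.
Qed.

Lemma UsetE ii : Uset r u ii = [set p.1 + p.2 * ii | p in C].
Proof. by rewrite conicE -imset_comp; apply: eq_imset. Qed.

(** The origin is the nucleus: two points of the conic on a line through it have
determinant 0, so their sum has norm 1 + 1 = 0 and vanishes by anisotropy. *)
Lemma card_conic_tangent (f g : K) : (f, g) != 0 ->
  (#|[set p in C | (f * p.1 + g * p.2 == 0)%R]| <= 1)%N.
Proof.
move=> fg; apply/card_le1_eqP => p p'.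
move=> /setIdP[/setIdP[pF /eqP Qp] /eqP lp] /setIdP[/setIdP[pF' /eqP Qp'] /eqP lp'].
have det0 : p.1 * p'.2 + p'.1 * p.2 = 0.
  move: fg; rewrite xpair_eqE negb_and => /orP[] c0; apply: (mulfI c0); rewrite mulr0.
    transitivity ((f * p.1 + g * p.2) * p'.2 + (f * p'.1 + g * p'.2) * p.2).
      by apply: (eq_mod2 ch2 (z := - (g * p.2 * p'.2))); ring.
    by rewrite lp lp'; ring.
  transitivity ((f * p.1 + g * p.2) * p'.1 + (f * p'.1 + g * p'.2) * p.1).
    by apply: (eq_mod2 ch2 (z := - (f * p.1 * p'.1))); ring.
  by rewrite lp lp'; ring.
have: p + p' = 0.
  apply: norm_form_anisotropic.
    exact: (subGF_pairD ch2).
  by rewrite (norm_formD _ _ _ ch2) Qp Qp' det0 mulr0 addr0 (addxx ch2).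
case: p p' {pF pF' Qp Qp' lp lp' det0} => [x y] [x' y'] E.
move: (congr1 fst E) (congr1 snd E) => /= /eqP + /eqP.
by rewrite !(addr_eq0_char2 ch2) => /eqP-> /eqP->.
Qed.

(** If p is one solution, the line is p + a (g, f), and Q (p + a (g, f)) = 1 is a
quadratic equation in a whose linear coefficient is b * (f * p.1 + g * p.2) = b; its roots are
0 and b / Q (g, f), both in F' and distinct. *)
Lemma card_conic_secant (f g : K) : f \in F' -> g \in F' ->
  #|[set p in C | f * p.1 + g * p.2 == 1]| \in [:: 0; 2]%N.
Proof.
move=> fF gF; set X := [set p in _ | _].
have [->|[p pX]] := set_0Vmem X; first by rewrite cards0.
have [/setIdP[pF /eqP Qp] /eqP lp] := setIdP pX.
have fgF : (g, f) \in setX F' F' by apply/setXP.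
have Q0 : Q (g, f) != 0.
  apply/eqP => /(norm_form_anisotropic fgF) [g0 f0].
  by move/eqP: lp; rewrite g0 f0 !mul0r addr0 eq_sym oner_eq0.
have [s sE] : exists s, s = b / Q (g, f) by eexists.
have sF : s \in F'.
  rewrite sE.
  apply: subGFM; first exact: conic_coef_subGF.
  apply: subGFV; rewrite /norm_form /= !expr2.
  by do !apply: (subGFD ch2); do ?apply: subGFM => //; apply: conic_coef_subGF.
have s0 : s != 0 by rewrite sE mulf_neq0 ?invr_eq0 ?conic_coef_neq0.
suff -> : X = [set p; p + (s * g, s * f)].
  rewrite cards2; case: eqP => // /(congr1 (fun z => z - p)).
  rewrite subrr addrAC subrr add0r => E.
  move: (congr1 fst E) (congr1 snd E) => /= /esym/eqP + /esym/eqP.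
  rewrite !mulf_eq0 (negPf s0) /= => /eqP g0 /eqP f0.
  by move: Q0; rewrite g0 f0 /norm_form /= !mulr0 !expr0n /= !addr0 eqxx.
have Qtr a : Q (p + (a * g, a * f)) = 1 + a ^+ 2 * Q (g, f) + a * b.
  rewrite (norm_formD _ _ _ ch2) norm_formZ Qp /=; congr (_ + _).
  by rewrite -[in RHS](mulr1 b) -lp; ring.
apply/setP => p'; rewrite in_set2; apply/idP/orP => [|[/eqP-> //|/eqP->]].
  case/setIdP => /setIdP[pF' /eqP Qp'] /eqP lp'.
  have [a p'E] : exists a, p' = p + (a * g, a * f).
    have gf0 : (g, f) != 0.
      by apply: contra_neq Q0 => ->; rewrite /norm_form /= !mulr0 !expr0n /= !addr0.
    have det0 : (p + p').1 * f + (p + p').2 * g = 0.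
      transitivity ((f * p.1 + g * p.2) + (f * p'.1 + g * p'.2)); first by rewrite /=; ring.
      by rewrite lp lp' (addxx ch2).
    have ppF := subGF_pairD ch2 pF pF'.
    have [a _ ppE] := proportional_of_det0 ch2 ppF fgF gf0 det0.
    exists a; rewrite -ppE addrA [p + p](_ : _ = 0) ?add0r //.
    by apply: injective_projections; apply: (addxx ch2).
  move: Qp'; rewrite p'E Qtr -addrA => /(canRL (addKr _)); rewrite addNr => /eqP.
  rewrite expr2 -mulrA -mulrDr mulf_eq0 => /orP[/eqP->|].
    by left; rewrite !mul0r [X in p + X](_ : _ = 0) // addr0.
  by rewrite (addr_eq0_char2 ch2) => /eqP aQ; right; rewrite sE -[X in X / _]aQ mulfK.
rewrite inE; apply/andP; split; last first.
  rewrite /= -{}lp; apply/eqP.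
  by apply: (eq_mod2 ch2 (z := s * f * g)); ring.
rewrite inE; apply/andP; split.
  by apply: (subGF_pairD ch2 pF); apply: (subGF_pairZ sF fgF).
by rewrite Qtr expr2 -mulrA {2}sE divfK // -addrA (addxx ch2) addr0.
Qed.

End Conic.

(** * Points, lines and elations of the projective plane *)

Section Plane.

Variables (K : finFieldType) (m : nat).
Local Notation q := (2 ^ m)%N.
Hypotheses (ch2 : 2%N \in [pchar K]) (cK : #|K| = (q ^ 2)%N).
Local Notation F := (subGF K q).
Local Notation ip := (@ip K q).
Local Notation hc := (hcoord K q).
Implicit Types (a x y e : K) (p R : K * K).

Lemma qconjK x : (x ^+ q) ^+ q = x.
Proof. by rewrite -exprM mulnn -cK expf_card. Qed.

Lemma ip_subGF a x : ip a x \in F.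
Proof.
rewrite inE /Defs.ip /qconj (expr2kD ch2) !exprMn !qconjK.
by apply/eqP; ring.
Qed.

Lemma ipDr a x y : ip a (x + y) = ip a x + ip a y.
Proof. by rewrite /Defs.ip /qconj (expr2kD ch2); ring. Qed.

Lemma ipDl a x y : ip (x + y) a = ip x a + ip y a.
Proof. by rewrite /Defs.ip /qconj (expr2kD ch2); ring. Qed.

Lemma ipZr s a x : s \in F -> ip a (s * x) = s * ip a x.
Proof. by rewrite inE /Defs.ip /qconj exprMn => /eqP->; ring. Qed.

Lemma ipZl s a x : s \in F -> ip (s * a) x = s * ip a x.
Proof. by rewrite inE /Defs.ip /qconj exprMn => /eqP->; ring. Qed.

Lemma ip0r a : ip a 0 = 0.
Proof. by rewrite -(mul0r 0) ipZr ?mul0r // subGF0. Qed.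

Lemma ip_self a : ip a a = 0.
Proof. by rewrite /Defs.ip mulrC addxx. Qed.

Lemma ip_nondegenerate ii a : ii + ii ^+ q = 1 -> ip a 1 = 0 -> ip a ii = 0 -> a = 0.
Proof.
rewrite /Defs.ip /qconj expr1n !mulr1 => iiE /eqP.
rewrite (addr_eq0_char2 ch2) => /eqP <-.
by rewrite -mulrDr [_ + ii]addrC iiE mulr1.
Qed.

Lemma ip_mul a x y : ip a (x * y) = ip (a * x ^+ q) y.
Proof. by rewrite /Defs.ip /qconj !exprMn qconjK; ring. Qed.

(** <1, -> takes the value t at s + t ii, which recovers the coordinates. *)
Lemma conj_basis_free ii x y x' y' : ii + ii ^+ q = 1 ->
  x \in F -> y \in F -> x' \in F -> y' \in F ->
  x + y * ii = x' + y' * ii -> (x, y) = (x', y').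
Proof.
move=> iiE xF yF xF' yF' E; have yE : y = y'.
  have trE s t : s \in F -> t \in F -> ip 1 (s + t * ii) = t.
    move=> sF tF; rewrite ipDr -[s]mulr1 !ipZr // ip_self mulr0 add0r.
    by rewrite /Defs.ip /qconj expr1n !mul1r addrC iiE mulr1.
  by rewrite -(trE x y xF yF) E trE.
by move: E; rewrite yE => /addIr->.
Qed.

(** Total in p, so that it can be used without carrying membership proofs; outside
hcoord the value is a dummy point. *)
Definition pgpt p : pgpoint K q := insubd (affine q 0) (hclass q p).

Lemma val_pgpt p : p \in hc -> val (pgpt p) = hclass q p.
Proof. by move=> pc; rewrite insubdK // imset_f. Qed.

Lemma hcoordE p : (p \in hc) = (p.2 \in F) && (p != 0).
Proof. by rewrite !inE. Qed.

Lemma hclass_refl p : p \in hclass q p.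
Proof.
by apply/imsetP; exists 1; rewrite ?inE ?subGF1 ?oner_eq0 ?expr1n ?eqxx // !mul1r; case: p.
Qed.

Definition pgrep (P : pgpoint K q) : K * K := odflt (0, 1) [pick p in hc | pgpt p == P].

Lemma pgrepP P : pgrep P \in hc /\ pgpt (pgrep P) = P.
Proof.
rewrite /pgrep; case: pickP => [p /andP[pc /eqP] //|none].
have /imsetP[p pc pE] := valP P; case/negP: (negbT (none p)).
by rewrite pc /=; apply/eqP/val_inj; rewrite val_pgpt // pE.
Qed.

Lemma hcoordZ s p : s \in F -> s != 0 -> p \in hc -> (s * p.1, s * p.2) \in hc.
Proof.
move=> sF s0; rewrite !hcoordE => /andP[pF p0]; rewrite subGFM //=.
apply: contra p0 => /eqP E; move: (congr1 fst E) (congr1 snd E) => /= /eqP + /eqP.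
by rewrite !mulf_eq0 (negPf s0) /=; case: p {pF E} => x y /= /eqP-> /eqP->.
Qed.

Lemma pgptZ s p : s \in F -> s != 0 -> p \in hc -> pgpt (s * p.1, s * p.2) = pgpt p.
Proof.
move=> sF s0 pc; apply: val_inj; rewrite !val_pgpt ?hcoordZ //.
apply/setP => p'; apply/imsetP/imsetP => -[k /setD1P[k0 kF] ->] /=.
  exists (k * s); last by rewrite !mulrA.
  by rewrite in_setD1 mulf_neq0 // subGFM.
exists (k / s); last by rewrite !mulrA !divfK.
by rewrite in_setD1 mulf_neq0 ?invr_eq0 // subGFM // subGFV.
Qed.

Lemma pgpt_eq p p' : p \in hc -> p' \in hc -> pgpt p = pgpt p' ->
  exists s, [/\ s \in F, s != 0 & p = (s * p'.1, s * p'.2)].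
Proof.
move=> pc pc' /(congr1 val); rewrite !val_pgpt // => E.
have := hclass_refl p; rewrite E => /imsetP[s /setD1P[s0 sF] pE].
by exists s.
Qed.

Lemma mem_pgline a (z : K) p : p \in hc ->
  (pgpt p \in pgline q a z) = (ip a p.1 + z * p.2 == 0).
Proof.
move=> pc; rewrite inE val_pgpt //; apply/forall_inP/idP => [/(_ _ (hclass_refl p)) //|/eqP E].
move=> _ /imsetP[s /setD1P[s0 sF] ->] /=.
by rewrite ipZr // mulrCA -mulrDr E mulr0.
Qed.

Lemma affineE x : affine q x = pgpt (x, 1).
Proof. by apply: val_inj; rewrite val_pgpt // affine_hcoord. Qed.

Lemma pglineP l : l \in pglines K q -> exists a z, (a, z) \in hc /\ l = pgline q a z.
Proof. by case/imsetP => -[a z] az ->; exists a, z. Qed.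

Lemma pgline_in a z : (a, z) \in hc -> pgline q a z \in pglines K q.
Proof. by move=> az; apply/imsetP; exists (a, z). Qed.

Section Elation.

Variables (e : K) (R : K * K).
Hypotheses (e0 : e != 0) (RF : R.2 \in F) (eR : ip e R.1 = 0).

(** The linear map p |-> p + <e, p> R: it fixes the hyperplane <e, -> = 0, which
contains R, and is an involution in characteristic 2. *)
Definition transvection p := (p.1 + ip e p.1 * R.1, p.2 + ip e p.1 * R.2).

Lemma ip_transvection p : ip e (transvection p).1 = ip e p.1.
Proof. by rewrite /= ipDr ipZr ?ip_subGF // eR mulr0 addr0. Qed.

Lemma transvectionK : involutive transvection.
Proof.
move=> p; rewrite /transvection /= ip_transvection -!addrA !(addxx ch2) !addr0.
by case: p.
Qed.

Lemma transvectionZ s p : s \in F ->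
  transvection (s * p.1, s * p.2) = (s * (transvection p).1, s * (transvection p).2).
Proof. by move=> sF; rewrite /transvection /= ipZr //; congr (_, _); ring. Qed.

Lemma transvection_hcoord p : p \in hc -> transvection p \in hc.
Proof.
rewrite !hcoordE => /andP[pF p0]; apply/andP; split.
  by apply: (subGFD ch2) => //; apply: subGFM => //; apply: ip_subGF.
apply: contra p0 => /eqP E; rewrite -[p]transvectionK E.
by rewrite /transvection /= ip0r !mul0r !addr0.
Qed.

Definition elation_fun (P : pgpoint K q) := pgpt (transvection (pgrep P)).

Lemma elation_pgpt p : p \in hc -> elation_fun (pgpt p) = pgpt (transvection p).
Proof.
move=> pc; have [rc E] := pgrepP (pgpt p).
have [s [sF s0 rE]] := pgpt_eq rc pc E.
by rewrite /elation_fun rE transvectionZ // pgptZ // transvection_hcoord.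
Qed.

Lemma elation_funK : involutive elation_fun.
Proof.
move=> P; have [pc <-] := pgrepP P.
by rewrite !elation_pgpt ?transvection_hcoord // transvectionK.
Qed.

Definition elation : {perm pgpoint K q} := perm (inv_inj elation_funK).

Lemma elationE p : p \in hc -> elation (pgpt p) = pgpt (transvection p).
Proof. by move=> pc; rewrite permE elation_pgpt. Qed.

Lemma elationK : involutive elation.
Proof. by move=> P; rewrite !permE elation_funK. Qed.

(** As the transvection is its own inverse, the image of a line is given by composing
its equation with the transvection. *)
Lemma elation_pgline a z : z \in F ->
  elation @: pgline q a z = pgline q (a + (ip a R.1 + z * R.2) * e) z.
Proof.
move=> zF; apply/setP => P; rewrite (can_imset_pre _ elationK) inE.
have [pc <-] := pgrepP P; rewrite elationE // !mem_pgline ?transvection_hcoord //=.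
set p := pgrep P.
have cF : ip a R.1 + z * R.2 \in F by rewrite (subGFD ch2) ?ip_subGF ?subGFM.
rewrite ipDr ipDl ipZr ?ip_subGF // ipZl //; congr (_ == 0); ring.
Qed.

Lemma elation_collineation : is_collineation elation.
Proof.
apply/forall_inP => _ /pglineP[a [z [az ->]]].
have zF : z \in F by move: az; rewrite hcoordE => /andP[].
rewrite elation_pgline //; apply: pgline_in; move: az; rewrite !hcoordE zF /=.
apply: contra => /eqP[+ z0]; rewrite z0 mul0r addr0 => a0.
have aR : ip a R.1 = 0.
  have: ip (a + ip a R.1 * e) R.1 = 0.
    by rewrite a0 /Defs.ip /qconj expr0n expn_eq0 /= !mul0r addr0.
  by rewrite ipDl ipZl ?ip_subGF // eR mulr0 addr0.
by move: a0; rewrite aR mul0r addr0 => ->.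
Qed.

Lemma elation_in_elations : elation \in elations (pgline q e 0).
Proof.
(* The centre is R; if R = 0 any point of the axis will do, and (e : 0) is one
   because <e, e> = 0. *)
have [C [Cc eC CR]] : exists C, [/\ C \in hc, ip e C.1 = 0 &
    forall a z, ip a C.1 + z * C.2 = 0 -> ip a R.1 + z * R.2 = 0].
  have [R0|R0] := eqVneq R 0; last by exists R; rewrite hcoordE RF R0; split.
  exists (e, 0); split; last by move=> a z _; rewrite R0 /= ip0r mulr0 addr0.
    by rewrite hcoordE subGF0 xpair_eqE negb_and e0.
  exact: ip_self.
rewrite inE; apply/existsP; exists (pgpt C).
rewrite mem_pgline // eC mul0r addr0 eqxx /=; apply/and3P; split.
- exact: elation_collineation.
- apply/forall_inP => P; have [pc <-] := pgrepP P.
  rewrite mem_pgline // mul0r addr0 elationE // /transvection => /eqP ->.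
  by rewrite !mul0r !addr0; case: (pgrep P).
apply/forall_inP => _ /pglineP[a [z [az ->]]].
have zF : z \in F by move: az; rewrite hcoordE => /andP[].
apply/implyP; rewrite mem_pgline // => /eqP/CR cR.
by rewrite elation_pgline // cR mul0r addr0.
Qed.

End Elation.
End Plane.

(** Elations fix the axis pointwise, hence preserve H minus the axis as soon as they
preserve H; so moving any point there to any other is enough. *)
Lemma translation_KM_arc_of_swap (K : finFieldType) (q t : nat) (H l : {set pgpoint K q}) :
  (0 < q)%N -> (2 < t)%N -> is_KM_arc t H -> l \in pglines K q ->
  {in H :\: l &, forall x y, exists g : {perm pgpoint K q},
    [/\ g \in elations l, g @: H = H & g x = y]} ->
  is_translation_KM_arc t H l.
Proof.
move=> q0 t2 KM ll swap; split=> //.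
have [x xS] : exists x, x \in H :\: l.
  apply/set0Pn; rewrite -card_gt0 cardsD KM.1 subn_gt0.
  apply: (@leq_ltn_trans t); last by rewrite -[X in (X < _)%N]add0n ltn_add2r.
  have := KM.2 _ ll; rewrite !inE => /or3P[] /eqP-> //; exact: ltnW.
apply/imsetP; exists x => //; apply/eqP; rewrite eqEsubset; apply/andP; split.
  apply/subsetP => y yS; have [g [gE gH <-]] := swap x y xS yS.
  by apply/imsetP; exists g; rewrite ?inE ?apermE // gH eqxx andbT; move: gE; rewrite inE.
apply/subsetP => _ /imsetP[g + ->]; rewrite in_set => /andP[gE /eqP gH] /=.
rewrite apermE; have /setDP[xH xl] := xS.
apply/setDP; split; first by rewrite -gH imset_f.
apply: contra xl => gl; move: gE.
rewrite in_set => /existsP[R /andP[_ /and3P[_ /forall_inP fixl _]]].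
by have /eqP/perm_inj gx := fixl _ gl; rewrite -gx.
Qed.

(** * The arc and its intersections with lines *)

Section Arc.

Variables (m h : nat) (K : finFieldType) (u ii c : K).
Local Notation q := (2 ^ m)%N.
Local Notation r := (2 ^ h)%N.
Local Notation n := (m %/ h)%N.
Local Notation t := (q %/ r)%N.
Hypotheses (hm : (h %| m)%N) (t_gt2 : (2 < t)%N) (cK : #|K| = (q ^ 2)%N).
Hypotheses (gen_u : generates u (Sprime K r)) (iiE : ii + ii ^+ q = 1) (c0 : c != 0).
Local Notation b := (u + u ^+ r).
Local Notation Q := (norm_form b).
Local Notation F := (subGF K q).
Local Notation F' := (subGF K r).
Local Notation C := (conic r b).
Local Notation V := (V1 K q r n).
Local Notation Tr := (@rel_trace K r n).
Local Notation H := (affine q @: Hr q r n u ii c).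
Local Notation hc := (hcoord K q).

Let m_gt0 : (0 < m)%N.
Proof. by case: m t_gt2 => //; rewrite expn0 => /leq_trans/(_ (leq_div 1 _)). Qed.

Let h_gt0 : (0 < h)%N.
Proof. by case: h hm => //; rewrite dvd0n => /eqP m0; have := m_gt0; rewrite m0. Qed.

Let n_gt0 : (0 < n)%N.
Proof. by rewrite divn_gt0 ?h_gt0 // dvdn_leq // m_gt0. Qed.

Let qE : q = (r ^ n)%N.
Proof. by rewrite -expnM mulnC divnK. Qed.

Let tE : t = (r ^ n.-1)%N.
Proof. by rewrite qE -{1}(prednK n_gt0) expnSr mulnK // expn_gt0. Qed.

Let ch2 : 2%N \in [pchar K].
Proof. by apply: (@card_finPcharP _ _ (m * 2)) => //; rewrite cK -!expnM. Qed.

Let cK' : #|K| = ((r ^ 2) ^ n)%N.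
Proof. by rewrite cK qE expnAC. Qed.

Let F'F : {subset F' <= F}.
Proof. by rewrite qE; apply: subGF_expn. Qed.

Let TrF x : x \in F -> Tr x \in F'.
Proof. by rewrite qE; apply: rel_trace_subGF ch2 _. Qed.

Lemma card_V1 : #|V| = t.
Proof.
rewrite tE -(card_rel_trace_fibre ch2 h_gt0 n_gt0 _ (subGF1 _ _) (e := 2)); last first.
  by rewrite -qE.
by rewrite -qE.
Qed.

Lemma in_V1 v : v \in V = (v \in F) && (Tr v == 1).
Proof. by rewrite !inE. Qed.

Lemma V1_neq0 v : v \in V -> v != 0.
Proof.
rewrite in_V1 => /andP[_]; apply: contraL => /eqP->.
by rewrite (rel_trace0 _ _ ch2) eq_sym oner_eq0.
Qed.

(** With x = (v, p) and w the vector of U with coordinates p, this represents the affine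
point w / (c * v) without denominators in v. *)
Definition arc_coord (x : K * (K * K)) : K * K := (c^-1 * (x.2.1 + x.2.2 * ii), x.1).
Definition arc_point x := pgpt m (arc_coord x).

Lemma arc_hcoord x : x \in setX V C -> arc_coord x \in hc.
Proof.
case: x => v p /setXP[vV _]; rewrite hcoordE xpair_eqE negb_and (V1_neq0 vV) orbT andbT.
by move: vV; rewrite in_V1 => /andP[].
Qed.

Lemma arcE : H = [set arc_point x | x in setX V C].
Proof.
have [e0 e1] := (h_gt0, cK').
have key v p : v \in V -> p \in C ->
    affine q ((c * v)^-1 * (p.1 + p.2 * ii)) = arc_point (v, p).
  move=> vV pC; have v0 := V1_neq0 vV.
  have vF : v \in F by move: vV; rewrite in_V1 => /andP[].
  rewrite affineE -(pgptZ vF v0) ?affine_hcoord //=; congr pgpt.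
  by rewrite /arc_coord /= mulr1 invfM mulrCA !mulrA divfK // mulrC !mulrA.
apply/setP => P; apply/imsetP/imsetP => [[x /imset2P[l w] + + -> ->]|[[v p] /setXP[vV pC] ->]].
  rewrite inE (UsetE e0 e1 gen_u) => /imsetP[v vV lE] /imsetP[p pC ->].
  exists (v, p); first exact/setXP.
  by rewrite -[l]invrK lE key.
exists ((c * v)^-1 * (p.1 + p.2 * ii)); last by rewrite key.
apply/imset2P; exists (c * v)^-1 (p.1 + p.2 * ii) => //.
  by rewrite inE invrK; apply: imset_f.
by rewrite (UsetE e0 e1 gen_u); apply: (imset_f (fun p => p.1 + p.2 * ii)).
Qed.

(** Two proportional coordinate vectors have a ratio in F', since their conic parts are
in F'^2; by linearity of the trace, which is 1 on both, the ratio is 1. *)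
Lemma arc_point_inj : {in setX V C &, injective arc_point}.
Proof.
move=> [v p] [v' p'] vp vp' /(pgpt_eq (arc_hcoord vp) (arc_hcoord vp')) [s [sF s0]].
case/setXP: vp => vV /conicP[xF yF Qp]; case/setXP: vp' => vV' pC'.
have [xF' yF' Qp'] := conicP pC'.
case=> E /= vE; have {}E : p.1 + p.2 * ii = s * p'.1 + s * p'.2 * ii.
  by apply: (mulfI (_ : c^-1 != 0)); rewrite ?invr_eq0 // E; ring.
have [E1 E2] : (p.1, p.2) = (s * p'.1, s * p'.2).
  by apply: (conj_basis_free ch2 iiE _ _ _ _ E); rewrite ?subGFM // F'F.
have sF' : s \in F'.
  have [x0|x0] := eqVneq p'.1 0; last by rewrite -(mulfK x0 s) -E1 subGFM ?subGFV.
  have y0 : p'.2 != 0.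
    by apply: contra (conic_neq0 pC') => /eqP y0; case: (p') x0 y0 => x y /= -> ->.
  by rewrite -(mulfK y0 s) -E2 subGFM ?subGFV.
have s1 : s = 1.
  move: vV vV'; rewrite !in_V1 vE => /andP[_ /eqP] + /andP[_ /eqP T'].
  by rewrite rel_traceZ // T' mulr1.
move: vE E1 E2; rewrite s1 !mul1r => -> E1 E2.
by congr (_, _); apply: injective_projections.
Qed.

Lemma card_arc : #|H| = (q + t)%N.
Proof.
rewrite arcE (card_in_imset arc_point_inj) cardsX card_V1 (card_conic h_gt0 cK' gen_u).
by rewrite mulnS addnC divnK // dvdn_exp2l // dvdn_leq // m_gt0.
Qed.

Lemma ip_coord a p : p.1 \in F -> p.2 \in F ->
  ip q a (c^-1 * (p.1 + p.2 * ii)) = ip q a c^-1 * p.1 + ip q a (c^-1 * ii) * p.2.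
Proof.
move=> xF yF; rewrite mulrDr mulrCA (mulrC c^-1) (ipDr _ ch2).
rewrite (ipZr _ _ xF) (ipZr _ _ yF); by congr (_ + _); apply: mulrC.
Qed.

Section Line.

Variables a z : K.
Hypothesis az : (a, z) \in hc.
Let f := ip q a c^-1.
Let g := ip q a (c^-1 * ii).

Let fF : f \in F. Proof. exact: (ip_subGF ch2 cK). Qed.
Let gF : g \in F. Proof. exact: (ip_subGF ch2 cK). Qed.

Lemma ip_conic p : p \in C -> ip q a (c^-1 * (p.1 + p.2 * ii)) = f * p.1 + g * p.2.
Proof. by case/conicP=> xF yF _; rewrite ip_coord // F'F. Qed.

Lemma card_arc_line :
  #|H :&: pgline q a z| =
  #|[set x in setX V C | f * x.2.1 + g * x.2.2 + z * x.1 == 0]|.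
Proof.
rewrite -(card_in_imset (f := arc_point)); last first.
  by move=> x y /setIdP[xA _] /setIdP[yA _]; apply: arc_point_inj.
apply: eq_card => P; rewrite arcE inE; apply/andP/imsetP => [[/imsetP[x xA ->]]|[x]].
  rewrite mem_pgline ?arc_hcoord //= => E; exists x => //; rewrite inE xA /=.
  by move: E; rewrite ip_conic //; case: x xA => ? ? /setXP[].
case/setIdP => xA E ->; rewrite imset_f // mem_pgline ?arc_hcoord //= ip_conic //.
by case: x xA {E} => ? ? /setXP[].
Qed.

(** Over each conic point on the line lie t points of the arc, one for each v. *)
Lemma card_arc_line_nucleus : z = 0 ->
  #|H :&: pgline q a z| \in [:: 0; t]%N.
Proof.
move=> z0; rewrite card_arc_line.
have -> : [set x in setX V C | f * x.2.1 + g * x.2.2 + z * x.1 == 0] =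
          setX V [set p in C | f * p.1 + g * p.2 == 0].
  by apply/setP => -[v p]; rewrite !inE /= z0 mul0r addr0 !andbA.
have fg : (f, g) != 0.
  apply/eqP => -[f0 g0].
  have : a * c^-1 ^+ q = 0.
    by apply: (ip_nondegenerate ch2 iiE); rewrite -(ip_mul cK) ?mulr1.
  move/eqP; rewrite mulf_eq0 expf_eq0 invr_eq0 (negPf c0) andbF orbF => /eqP a0.
  by move: az; rewrite hcoordE a0 z0 eqxx andbF.
rewrite cardsX card_V1; have := card_conic_tangent h_gt0 cK' gen_u fg.
by case: #|_| => [|[|k]] // _; rewrite ?muln0 ?muln1 !inE eqxx ?orbT.
Qed.

(** The equation determines v from p, and taking its trace turns Tr v = 1 into the
equation of a line of the plane over F'. *)
Lemma card_arc_line_secant : z != 0 ->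
  #|H :&: pgline q a z| \in [:: 0; 2]%N.
Proof.
move=> z0; rewrite card_arc_line.
have zF : z \in F by move: az; rewrite hcoordE => /andP[].
have fzF : f / z \in F by rewrite subGFM ?subGFV.
have gzF : g / z \in F by rewrite subGFM ?subGFV.
rewrite (_ : #|_| = #|[set p in C | Tr (f / z) * p.1 + Tr (g / z) * p.2 == 1]|); last first.
  rewrite -[RHS](card_in_imset (f := fun p => ((f * p.1 + g * p.2) / z, p))); last first.
    by move=> p p' _ _ [].
  apply: eq_card => -[v p].
  apply/setIdP/imsetP => [[/setXP[vV pC] /= E]|[p' /setIdP[pC T1] [-> ->]]].
    have vE : v = (f * p.1 + g * p.2) / z.
      apply: (mulIf z0); rewrite divfK // mulrC; apply/eqP.
      by rewrite eq_sym -(addr_eq0_char2 ch2).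
    exists p; last by rewrite -vE.
    have [xF yF _] := conicP pC.
    rewrite inE pC /= ![Tr _ * _]mulrC -!rel_traceZ // -(rel_traceD _ _ ch2).
    move: vV; rewrite in_V1 => /andP[_]; rewrite vE; congr (Tr _ == 1); ring.
  have [xF yF _] := conicP pC; split; last first.
    by rewrite /= [z * _]mulrC divfK // (addxx ch2).
  apply/setXP; split=> //; rewrite in_V1; apply/andP; split.
    by rewrite subGFM ?subGFV // (subGFD ch2) // subGFM // F'F.
  move: T1; rewrite ![Tr _ * _]mulrC -!rel_traceZ // -(rel_traceD _ _ ch2).
  congr (Tr _ == 1); ring.
exact: (card_conic_secant h_gt0 cK' gen_u) (TrF fzF) (TrF gzF).
Qed.

End Line.

Lemma arc_is_KM_arc : is_KM_arc t H.
Proof.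
split=> [|_ /pglineP[a [z [az ->]]]]; first exact: card_arc.
have [z0|z0] := eqVneq z 0.
  by have := card_arc_line_nucleus az z0; rewrite !inE => /orP[->|->]; rewrite ?orbT.
by have := card_arc_line_secant az z0; rewrite !inE => /orP[->|->]; rewrite ?orbT.
Qed.

Lemma arc_nucleus : is_t_nucleus t H (affine q 0).
Proof.
move=> _ /pglineP[a [z [az ->]]] Ht.
rewrite affineE mem_pgline ?affine_hcoord //= (ip0r _ a) add0r mulr1.
apply/negPn/negP => z0; have := card_arc_line_secant az z0.
by rewrite Ht !inE => /orP[] /eqP tE'; move: t_gt2; rewrite tE'.
Qed.

(** Dividing by Tr v, which is nonzero since Q is anisotropic, normalises both the norm
of p and the trace of v to 1. *)
Lemma cone_in_arc p v : p \in setX F' F' -> p != 0 -> v \in F -> Tr v ^+ 2 = Q p ->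
  pgpt m (arc_coord (v, p)) \in H.
Proof.
move=> pF p0 vF trQ; have sF' := TrF vF; set s := Tr v in trQ sF'.
have s0 : s != 0.
  apply: contra_neq p0 => s0; apply: (norm_form_anisotropic h_gt0 cK' gen_u pF).
  by rewrite -trQ s0 expr0n.
have sVF := subGFV sF'.
have [pF1 pF2] : s^-1 * p.1 \in F' /\ s^-1 * p.2 \in F'.
  by have /setXP := subGF_pairZ sVF pF.
have xA : (s^-1 * v, (s^-1 * p.1, s^-1 * p.2)) \in setX V C.
  apply/setXP; split.
    by rewrite in_V1 subGFM ?(F'F sVF) //= rel_traceZ // mulVf.
  apply/conicP; split=> //; rewrite norm_formZ -[(p.1, p.2)]surjective_pairing.
  by rewrite -trQ exprVn mulVf // expf_neq0.
rewrite arcE; apply/imsetP; exists (s^-1 * v, (s^-1 * p.1, s^-1 * p.2)) => //.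
rewrite /arc_point -(pgptZ (F'F sF') s0 (arc_hcoord xA)) /arc_coord /=.
congr (pgpt _ (_, _)); last by rewrite mulVKf.
transitivity (s * s^-1 * (c^-1 * (p.1 + p.2 * ii))); first by rewrite (divff s0) mul1r.
by ring.
Qed.

(** * Elations with axis a t-secant *)

Section Axis.

Variables (e : K) (w : K * K).
Hypotheses (e0 : e != 0) (wC : w \in C).
Hypothesis (ew : ip q e (c^-1 * (w.1 + w.2 * ii)) = 0).

Let det (p : K * K) := p.1 * w.2 + p.2 * w.1.

Let wF1 : w.1 \in F'. Proof. by case/conicP: wC. Qed.
Let wF2 : w.2 \in F'. Proof. by case/conicP: wC. Qed.

Lemma det_subGF p : p \in C -> det p \in F'.
Proof. by case/conicP=> ? ? _; rewrite (subGFD ch2) ?subGFM. Qed.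

(** The form <e, -> vanishes at w, hence is a multiple of det. *)
Lemma axis_form : exists2 k, k \in F & forall p, p \in setX F' F' ->
  ip q e (c^-1 * (p.1 + p.2 * ii)) = k * det p.
Proof.
pose f := (ip q e c^-1, ip q e (c^-1 * ii)).
have fF : f \in setX F F by apply/setXP; split; apply: (ip_subGF ch2 cK).
have wF : (w.2, w.1) \in setX F F by apply/setXP; split; apply: F'F.
have w0 : (w.2, w.1) != 0.
  apply: contra (conic_neq0 wC) => /eqP E.
  by apply/eqP/injective_projections; [apply: (congr1 snd E) | apply: (congr1 fst E)].
have fw : f.1 * w.1 + f.2 * w.2 = 0 by rewrite -ip_coord ?F'F.
have [k kF [fE gE]] := proportional_of_det0 ch2 fF wF w0 fw.
exists k => // -[x y] /setXP[xF yF].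
by rewrite ip_coord ?F'F // fE gE /det /=; ring.
Qed.

Section AxisElation.

Variables k al be : K.
Hypotheses (kF : k \in F) (k0 : k != 0) (alF : al \in F') (beF : be \in F).
Hypothesis kE : forall p, p \in setX F' F' ->
  ip q e (c^-1 * (p.1 + p.2 * ii)) = k * det p.
Hypothesis trE : Tr be ^+ 2 = al ^+ 2 + b * al.

(* Division by k compensates the factor between <e, -> and det. *)
Let R : K * K := (al / k * (c^-1 * (w.1 + w.2 * ii)), be / k).

Let RF : R.2 \in F. Proof. by rewrite subGFM // subGFV. Qed.

Let eR : ip q e R.1 = 0.
Proof. by rewrite ipZr ?ew ?mulr0 // subGFM ?subGFV // F'F. Qed.

Definition axis_elation : {perm pgpoint K q} := elation ch2 cK RF eR.

Lemma axis_elationE v p : (v, p) \in setX V C ->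
  axis_elation (arc_point (v, p)) =
  arc_point (v + det p * be, p + (det p * al * w.1, det p * al * w.2)).
Proof.
move=> xA; have /setXP[_ pC] := xA.
rewrite elationE ?arc_hcoord //; congr pgpt.
rewrite /transvection /= (kE (conic_subGF pC)) /arc_coord /=; congr (_, _).
  transitivity (c^-1 * (p.1 + p.2 * ii) + k / k * (det p * al * (c^-1 * (w.1 + w.2 * ii)))).
    by ring.
  by rewrite (divff k0); ring.
transitivity (v + k / k * (det p * be)); first by ring.
by rewrite (divff k0) mul1r.
Qed.

(** The elation changes both sides of Tr (v)^2 = Q p by the same amount, thanks to
trE; an injective map of H into itself is onto. *)
Lemma axis_elation_arc : axis_elation @: H = H.
Proof.
have [_ _ Qw] := conicP wC.
apply/eqP; rewrite eqEcard (card_imset _ (@perm_inj _ axis_elation)) leqnn andbT.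
apply/subsetP => _ /imsetP[x + ->]; rewrite {1}arcE => /imsetP[[v p] xA ->].
have /setXP[+ pC] := xA; rewrite in_V1 => /andP[vF /eqP T].
have [_ _ Qp] := conicP pC; have dF := det_subGF pC.
rewrite axis_elationE //; apply: cone_in_arc.
- apply: (subGF_pairD ch2); first exact: (conic_subGF pC).
  by apply: (@subGF_pairZ _ _ _ w); [rewrite subGFM | apply: (conic_subGF wC)].
- (* The vector added to p is a multiple of w, hence det is unchanged. *)
  apply/eqP => E; have d0 : det p = 0.
    have <- : det (p + (det p * al * w.1, det p * al * w.2)) = 0.
      by rewrite E /det /= !mul0r addr0.
    rewrite [RHS]/det /=.
    by apply: (eq_mod2 ch2 (z := - (det p * al * w.1 * w.2))); rewrite {1}/det; ring.
  move: E (conic_neq0 pC); rewrite d0 !mul0r [X in p + X](_ : _ = 0) // addr0.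
  by move=> ->; rewrite eqxx.
- by rewrite (subGFD ch2) // subGFM // F'F.
rewrite (rel_traceD _ _ ch2) rel_traceZ // T (norm_formD _ _ _ ch2) norm_formZ.
rewrite -surjective_pairing Qp Qw /=.
transitivity (1 + det p ^+ 2 * Tr be ^+ 2).
  by apply: (eq_mod2 ch2 (z := det p * Tr be)); ring.
rewrite trE [RHS](_ : _ = 1 + det p ^+ 2 * al ^+ 2 + b * (det p * al * det p)).
  by ring.
by rewrite /det; ring.
Qed.

End AxisElation.

(** The elation is forced: after rescaling to det = 1, its vector is the difference of
the two points, and trE is the difference of their equations Tr (v)^2 = Q p. *)
Lemma arc_swap : {in H :\: pgline q e 0 &, forall x y,
  exists g : {perm pgpoint K q},
  [/\ g \in elations (pgline q e 0), g @: H = H & g x = y]}.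
Proof.
have [k kF kE] := axis_form.
have off v p : (v, p) \in setX V C -> arc_point (v, p) \notin pgline q e 0 ->
    k != 0 /\ det p != 0.
  move=> xA; have /setXP[_ pC] := xA.
  rewrite mem_pgline ?arc_hcoord // mul0r addr0 (kE _ (conic_subGF pC)).
  by rewrite mulf_eq0 negb_or => /andP[].
move=> P P' /setDP[+ +] /setDP[+ +]; rewrite {1}arcE => /imsetP[[v1 p1] x1 ->] n1.
rewrite {1}arcE => /imsetP[[v2 p2] x2 ->] n2.
have [k0 d1] := off _ _ x1 n1; have [_ d2] := off _ _ x2 n2.
have /setXP[+ pC1] := x1; rewrite in_V1 => /andP[vF1 /eqP T1].
have /setXP[+ pC2] := x2; rewrite in_V1 => /andP[vF2 /eqP T2].
have [_ _ Q1] := conicP pC1; have [_ _ Q2] := conicP pC2.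
have [_ _ Qw] := conicP wC.
have iF1 := subGFV (det_subGF pC1); have iF2 := subGFV (det_subGF pC2).
(* Rescale both points so that det = 1: they then differ by an element of the
   kernel of det, which is spanned by w. *)
pose p1' := ((det p1)^-1 * p1.1, (det p1)^-1 * p1.2).
pose p2' := ((det p2)^-1 * p2.1, (det p2)^-1 * p2.2).
have pF1' : p1' \in setX F' F' by apply: subGF_pairZ; rewrite ?(conic_subGF pC1).
have pF2' : p2' \in setX F' F' by apply: subGF_pairZ; rewrite ?(conic_subGF pC2).
have det1 p : det p != 0 -> det ((det p)^-1 * p.1, (det p)^-1 * p.2) = 1.
  by move=> d0; rewrite {1}/det /= -!mulrA -mulrDr mulVf.
have [al alF alE] : exists2 al, al \in F' & p1' + p2' = (al * w.1, al * w.2).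
  apply: (proportional_of_det0 ch2 _ (conic_subGF wC) (conic_neq0 wC)).
    exact: (subGF_pairD ch2).
  rewrite -(addxx ch2 1) -{1}(det1 _ d1) -(det1 _ d2) -/p1' -/p2'.
  by rewrite /det /=; ring.
pose be := (det p1)^-1 * v1 + (det p2)^-1 * v2.
have beF : be \in F by rewrite (subGFD ch2) ?subGFM // F'F.
have TrbeE : Tr be = (det p1)^-1 + (det p2)^-1.
  by rewrite (rel_traceD _ _ ch2) !rel_traceZ // T1 T2 !mulr1.
have p2'E : p2' = p1' + (al * w.1, al * w.2).
  rewrite -alE addrA [p1' + p1'](_ : _ = 0) ?add0r //.
  by congr (_, _); apply: (addxx ch2).
have trE : Tr be ^+ 2 = al ^+ 2 + b * al.
  have : Q p2' = Q (p1' + (al * w.1, al * w.2)) by rewrite p2'E.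
  rewrite (norm_formD _ _ _ ch2) !norm_formZ -!surjective_pairing Q1 Q2 Qw !mulr1 /=.
  have -> : (det p1)^-1 * p1.1 * (al * w.2) + al * w.1 * ((det p1)^-1 * p1.2) = al.
    rewrite -[RHS]mulr1 -(det1 _ d1); move: (det p1)^-1 => i.
    by rewrite /det /=; ring.
  rewrite TrbeE => E; apply: (addrI ((det p1)^-1 ^+ 2)); rewrite addrA -E.
  by apply: (eq_mod2 ch2 (z := (det p1)^-1 ^+ 2 + (det p1)^-1 * (det p2)^-1)); ring.
exists (axis_elation kF alF beF); split.
- exact: elation_in_elations.
- exact: axis_elation_arc.
have s0 : det p1 / det p2 != 0 by rewrite mulf_neq0 ?invr_eq0.
have sF : det p1 / det p2 \in F by rewrite F'F // subGFM ?det_subGF.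
rewrite axis_elationE // {2}/arc_point -(pgptZ sF s0 (arc_hcoord x2)).
have -> : v1 + det p1 * be = det p1 / det p2 * v2.
  by rewrite /be mulrDr mulVKf // addrA (addxx ch2) add0r mulrA.
have -> : p1 + (det p1 * al * w.1, det p1 * al * w.2) =
    (det p1 / det p2 * p2.1, det p1 / det p2 * p2.2).
  move: (congr1 fst p2'E) (congr1 snd p2'E) => /= E1 E2.
  by apply: injective_projections; rewrite /= -[RHS]mulrA ?E1 ?E2 mulrDr mulVKf // -!mulrA.
by rewrite /arc_point /arc_coord /=; congr (pgpt _ (_, _)); ring.
Qed.

End Axis.
End Arc.

(* pgline (qconj q c) 0 is the line <1, c z> = 0, i.e. c^-1 times the line
   <1, z> = 0; it is l0 itself when c lies in the subfield of order q. *)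
Theorem theorem6 (m h : nat) (K : finFieldType) (u ii c : K) :
  let q := (2 ^ m)%N in
  let r := (2 ^ h)%N in
  let t := (q %/ r)%N in
  (h %| m)%N ->
  (2 < t)%N ->
  #|K| = (q ^ 2)%N ->
  generates u (Sprime K r) ->
  ii + ii ^+ q = 1 ->
  c != 0 ->
  let H := affine q @: Hr q r (m %/ h) u ii c in
  let l0 := pgline q (1 : K) 0 in
  [/\ is_KM_arc t H,
      is_t_nucleus t H (affine q 0),
      H :&: l0 != set0 -> is_translation_KM_arc t H l0
    & is_translation_KM_arc t H (pgline q (qconj q c) 0)].
Proof.
move=> q r t hm t2 cK gen_u iiE c0 H l0.
have KM : is_KM_arc t H by apply: arc_is_KM_arc.
have ch2 : 2%N \in [pchar K].
  by apply: (@card_finPcharP _ _ (m * 2)) => //; rewrite cK -!expnM.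
have transl e w : e != 0 -> w \in conic r (u + u ^+ r) ->
    ip q e (c^-1 * (w.1 + w.2 * ii)) = 0 ->
    is_translation_KM_arc t H (pgline q e 0).
  move=> e0 wC ew; apply: translation_KM_arc_of_swap => //; first by rewrite expn_gt0.
    by apply: pgline_in; rewrite hcoordE subGF0 xpair_eqE negb_and e0.
  exact: (arc_swap hm t2 cK gen_u e0 wC ew).
split=> //.
- exact: (arc_nucleus hm t2 cK gen_u iiE c0).
- case/set0Pn => P /setIP[]; rewrite {1}/H (arcE ii c hm t2 cK gen_u) => /imsetP[[v w] xA ->].
  rewrite mem_pgline ?(arc_hcoord _ _ cK xA) // mul0r addr0 => /eqP E.
  by have /setXP[_ wC] := xA; apply: (transl 1 w _ wC E); rewrite oner_eq0.
apply: (transl _ (1, 0)); rewrite ?expf_neq0 //.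
  apply/conicP; rewrite /norm_form /= subGF1 subGF0 mulr0 expr1n expr0n !addr0; split=> //.
by rewrite mul0r addr0 mulr1 /ip /qconj -exprM mulnn -cK expf_card -exprMn mulfV // expr1n addxx.
Qed.
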